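(* Let $\Gamma$ be a finitely generated group with a finite Abelianization and $\mathcal{E}$ a class of uniformly convex Banach spaces such that either $\mathcal{E}$ is closed under passing to ultraproducts or $\mathcal{E}=\mathcal{E}_{uc}$. Also, let $\mathcal{G}$ be a (non-directed) connected graph with a vertex set $V$. Assume that for every $v\in V$ there are subgroups $N^{v},H_{+}^{v},H_{-}^{v}<\Gamma$ such that the following holds: (1) For every $v\in V$, $N^{v}$ normalizes $H_{+}^{v}$ and $H_{-}^{v}$. (2) For every $v\in V$, $\langle H_{+}^{v},H_{-}^{v}\rangle=\Gamma$. (3) If $u,v\in V$ are adjacent, then, for each of the two choices of sign, $H_{\pm}^{u}<\langle H_{\pm}^{v},N^{v}\rangle$ and $H_{\pm}^{v}<\langle H_{\pm}^{u},N^{u}\rangle$. (4) $\langle H_{+}^{v},N^{v}:v\in V\rangle=\Gamma$. (5) For every $v\in V$, the pairs $(\Gamma,H_{+}^{v})$ and $(\Gamma,H_{-}^{v})$ have relative property $(F_{\mathcal{E}})$. Then $\Gamma$ has property $(F_{\mathcal{E}})$.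
   Context: $\Gamma$ is a discrete group. For a Banach space $\mathbb{E}$ and a subgroup $K<\Gamma$, $(\Gamma,K)$ has relative property $(F_{\mathbb{E}})$ if every affine isometric action of $\Gamma$ on $\mathbb{E}$ has a $K$-fixed point; $\Gamma$ has property $(F_{\mathbb{E}})$ if every affine isometric action of $\Gamma$ on $\mathbb{E}$ has a $\Gamma$-fixed point. For a class $\mathcal{E}$ of Banach spaces, (relative) property $(F_{\mathcal{E}})$ means (relative) property $(F_{\mathbb{E}})$ for every $\mathbb{E}\in\mathcal{E}$. $\mathcal{E}_{uc}$ is the class of all uniformly convex Banach spaces, where $\mathbb{E}$ is uniformly convex if there is $\delta:(0,2]\to(0,1]$ such that for all unit vectors $\xi,\eta$, $\|\xi-\eta\|\ge\varepsilon$ implies $\|\frac{\xi+\eta}{2}\|\le 1-\delta(\varepsilon)$. Fix a non-principal ultrafilter $\mathcal{U}$ on $\mathbb{N}$. The ultraproduct $\{\mathbb{E}_n\}_{\mathcal{U}}$ of a sequence of Banach spaces is the quotient of the space of bounded sequences $(\xi_n)_n$, $\xi_n\in\mathbb{E}_n$, by the subspace of sequences with $\lim_{n\to\mathcal{U}}\|\xi_n\|=0$, with norm $\lim_{n\to\mathcal{U}}\|\xi_n\|$. A class $\mathcal{E}$ is closed under passing to ultraproducts if the ultraproduct of every sequence of spaces in $\mathcal{E}$ belongs to $\mathcal{E}$. *)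

(* Defs.v *)
From HB Require Import structures.
From Stdlib Require Import Relation_Operators.
From mathcomp Require Import all_boot all_order all_algebra.
From mathcomp Require Import ring_quotient.
From mathcomp Require Import all_classical all_reals all_analysis.
From mathcomp Require Import lra.

Set Implicit Arguments.
Unset Strict Implicit.
Unset Printing Implicit Defensive.

Import Order.TTheory GRing.Theory Num.Theory.
Import numFieldNormedType.Exports.

Local Open Scope classical_set_scope.
Local Open Scope ring_scope.
Local Open Scope quotient_scope.

Section Groups.
Local Open Scope group_scope.
Variable G : groupType.

Definition subgroup (H : set G) : Prop :=
  [/\ H 1, (forall x y, H x -> H y -> H (x * y)) & (forall x, H x -> H x^-1)].

Definition generated (A : set G) : set G := smallest subgroup A.

Definition finitely_generated : Prop :=
  exists2 A : set G, finite_set A & generated A = setT.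

Definition commutator_subgroup : set G :=
  generated [set g | exists x y : G, g = [~ x, y]].

Definition lcoset (H : set G) (g : G) : set G := [set g * h | h in H].

(* The range below is the underlying set of the quotient of G by [G, G]. *)
Definition finite_abelianization : Prop :=
  finite_set (range (lcoset commutator_subgroup)).

Definition normalizes (N H : set G) : Prop :=
  forall n, N n -> [set h ^ n | h in H] = H.

End Groups.

Definition undirected (V : Type) (adj : V -> V -> Prop) : Prop :=
  forall u v, adj u v -> adj v u.

Definition connected_graph (V : Type) (adj : V -> V -> Prop) : Prop :=
  forall u v, clos_refl_trans V adj u v.

Section Actions.
Variables (R : realType) (G : groupType).

Definition affine_isometry (E : completeNormedModType R) (f : E -> E) : Prop :=
  exists (L : {linear E -> E}) (b : E),
    (forall x, `|L x| = `|x|) /\ (forall x, f x = L x + b).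

Definition affine_isometric_action (E : completeNormedModType R)
    (a : G -> E -> E) : Prop :=
  [/\ forall g, affine_isometry (a g),
      forall x, a 1%g x = x &
      forall g h x, a (g * h)%g x = a g (a h x)].

Definition fixed_point (E : completeNormedModType R) (a : G -> E -> E)
    (K : set G) (x : E) : Prop :=
  forall k, K k -> a k x = x.

Definition rel_property_F (K : set G) (E : completeNormedModType R) : Prop :=
  forall a : G -> E -> E, affine_isometric_action a ->
    exists x : E, fixed_point a K x.

Definition property_F (E : completeNormedModType R) : Prop :=
  rel_property_F setT E.

Definition rel_property_F_class (K : set G)
    (EE : completeNormedModType R -> Prop) : Prop :=
  forall E, EE E -> rel_property_F K E.

Definition property_F_class (EE : completeNormedModType R -> Prop) : Prop :=
  forall E, EE E -> property_F E.

End Actions.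

Arguments rel_property_F_class {R} G K EE.
Arguments property_F_class {R} G EE.

Definition uniformly_convex (R : realType) (E : completeNormedModType R) :
    Prop :=
  exists delta : R -> R,
    (forall eps, 0 < eps <= 2 -> 0 < delta eps <= 1) /\
    (forall eps, 0 < eps <= 2 -> forall x y : E, `|x| = 1 -> `|y| = 1 ->
       eps <= `|x - y| -> `|2^-1 *: (x + y)| <= 1 - delta eps).

Structure nonprincipal_ultrafilter := NonprincipalUltrafilter {
  ultrafilter_sets :> set_system nat;
  ultrafilter_ultra : UltraFilter ultrafilter_sets;
  ultrafilter_nonprincipal : forall n, ~ ultrafilter_sets [set n] }.

#[global] Existing Instance ultrafilter_ultra.

Section BoundedSequences.
Variables (R : realType) (E : nat -> completeNormedModType R).

Record bseq := BSeq {
  bseq_fun :> forall n, E n;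
  bseq_bounded : exists M : R, forall n, `|bseq_fun n| <= M }.

HB.instance Definition _ := gen_eqMixin bseq.
HB.instance Definition _ := gen_choiceMixin bseq.

Lemma bseqP (x y : bseq) : (forall n, x n = y n) -> x = y.
Proof.
case: x y => [x xM] [y yM] /= xy.
have {}xy : x = y by apply: functional_extensionality_dep.
by case: _ / xy yM => yM; congr BSeq; exact: Prop_irrelevance.
Qed.

Fact bseq0_bounded : exists M : R, forall n, `|0 : E n| <= M.
Proof. by exists 0 => n; rewrite normr0. Qed.

Fact bseqN_bounded (x : bseq) : exists M : R, forall n, `|- x n| <= M.
Proof. by have [M xM] := bseq_bounded x; exists M => n; rewrite normrN. Qed.

Fact bseqD_bounded (x y : bseq) : exists M : R, forall n, `|x n + y n| <= M.
Proof.
have [M xM] := bseq_bounded x; have [N yN] := bseq_bounded y.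
by exists (M + N) => n; rewrite (le_trans (ler_normD _ _))// lerD.
Qed.

Fact bseqZ_bounded k (x : bseq) : exists M : R, forall n, `|k *: x n| <= M.
Proof.
have [M xM] := bseq_bounded x; exists (`|k| * M) => n.
by rewrite normrZ ler_wpM2l ?normr_ge0 ?xM.
Qed.

Definition bseq0 := BSeq bseq0_bounded.
Definition bseqN x := BSeq (bseqN_bounded x).
Definition bseqD x y := BSeq (bseqD_bounded x y).
Definition bseqZ k x := BSeq (bseqZ_bounded k x).

Fact bseqDA : associative bseqD.
Proof. by move=> x y z; apply: bseqP => n /=; rewrite addrA. Qed.
Fact bseqDC : commutative bseqD.
Proof. by move=> x y; apply: bseqP => n /=; rewrite addrC. Qed.
Fact bseq0D : left_id bseq0 bseqD.
Proof. by move=> x; apply: bseqP => n /=; rewrite add0r. Qed.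
Fact bseqND : left_inverse bseq0 bseqN bseqD.
Proof. by move=> x; apply: bseqP => n /=; rewrite addNr. Qed.

HB.instance Definition _ :=
  GRing.isZmodule.Build bseq bseqDA bseqDC bseq0D bseqND.

Fact bseqZA k l x : bseqZ k (bseqZ l x) = bseqZ (k * l) x.
Proof. by apply: bseqP => n /=; rewrite scalerA. Qed.
Fact bseq1Z : left_id 1 bseqZ.
Proof. by move=> x; apply: bseqP => n /=; rewrite scale1r. Qed.
Fact bseqZDr : right_distributive bseqZ +%R.
Proof. by move=> k x y; apply: bseqP => n /=; rewrite scalerDr. Qed.
Fact bseqZDl x : {morph bseqZ^~ x : k l / k + l}.
Proof. by move=> k l; apply: bseqP => n /=; rewrite scalerDl. Qed.

HB.instance Definition _ :=
  GRing.Zmodule_isLmodule.Build R bseq bseqZA bseq1Z bseqZDr bseqZDl.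

Lemma bseqDE (x y : bseq) n : (x + y) n = x n + y n. Proof. by []. Qed.
Lemma bseqNE (x : bseq) n : (- x) n = - x n. Proof. by []. Qed.
Lemma bseqZE k (x : bseq) n : (k *: x) n = k *: x n. Proof. by []. Qed.
Lemma bseq0E n : (0 : bseq) n = 0. Proof. by []. Qed.

Lemma bseq_sumE (z : nat -> bseq) k n :
  (\sum_(i < k) z i) n = \sum_(i < k) z i n.
Proof.
elim: k => [|k IH]; first by rewrite !big_ord0.
by rewrite !big_ord_recr bseqDE IH.
Qed.

End BoundedSequences.

Section UltraLimit.
Variables (R : realType) (U : nonprincipal_ultrafilter).

Lemma fmap_ultra (T : Type) (f : nat -> T) : UltraFilter (f @ ultrafilter_sets U).
Proof.
split=> [|H HF UH]; first exact: fmap_proper_filter.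
apply/seteqP; split=> [A HA|]; last exact: UH.
have [//|UnA] := in_ultra_setVsetC (f @^-1` A) (ultrafilter_ultra U).
have : H (A `&` ~` A) by apply: filterI => //; apply: UH.
by rewrite setICr => /filter_not_empty.
Qed.

Lemma ultralimit_cvg (a : nat -> R) :
  (exists M : R, forall n, `|a n| <= M) -> cvg (a n @[n --> ultrafilter_sets U]).
Proof.
move=> [M aM].
have := @segment_compact R (- M) M; rewrite compact_ultra.
move=> /(_ _ (fmap_ultra a)) [|l [_ al]]; last exact: cvgP al.
apply: (@filterE _ (ultrafilter_sets U)) => n /=.
by rewrite in_itv/= -ler_norml aM.
Qed.

Variable E : nat -> completeNormedModType R.
Implicit Types x y : bseq E.

Definition ultralimit_norm x : R := lim (`|x n| @[n --> ultrafilter_sets U]).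

Lemma ultralimit_norm_cvg x : `|x n| @[n --> ultrafilter_sets U] --> ultralimit_norm x.
Proof.
apply: ultralimit_cvg; have [M xM] := bseq_bounded x.
by exists M => n; rewrite normr_id.
Qed.

#[local] Arguments ultralimit_norm_cvg : clear implicits.

Lemma ultralimit_norm_le x (M : R) :
  (forall n, `|x n| <= M) -> ultralimit_norm x <= M.
Proof.
move=> xM; apply: (cvgr_to_le (ultralimit_norm_cvg x)); exact: filterE.
Qed.

Lemma ultralimit_norm_ge0 x : 0 <= ultralimit_norm x.
Proof.
by apply: (cvgr_to_ge (ultralimit_norm_cvg x)); apply: filterE => n.
Qed.

Lemma ultralimit_normD x y :
  ultralimit_norm (x + y) <= ultralimit_norm x + ultralimit_norm y.
Proof.
apply: (ler_cvg_to (ultralimit_norm_cvg _)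
  (cvgD (ultralimit_norm_cvg x) (ultralimit_norm_cvg y))).
by apply: filterE => n; rewrite /= ler_normD.
Qed.

Lemma ultralimit_normZ k x :
  ultralimit_norm (k *: x) = `|k| * ultralimit_norm x.
Proof.
apply: (cvg_lim (@norm_hausdorff _ _)).
under eq_fun do rewrite bseqZE normrZ.
exact: cvgMr (ultralimit_norm_cvg x).
Qed.

Lemma ultralimit_normN x : ultralimit_norm (- x) = ultralimit_norm x.
Proof. by rewrite -scaleN1r ultralimit_normZ normrN1 mul1r. Qed.

Lemma ultralimit_norm0 : ultralimit_norm 0 = 0.
Proof. by rewrite -(scale0r 0) ultralimit_normZ normr0 mul0r. Qed.

Definition ultranull : {pred bseq E} := [pred x | ultralimit_norm x == 0].

Fact ultranull_zmod_closed : zmod_closed ultranull.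
Proof.
split=> [|x y]; rewrite !inE; first exact/eqP/ultralimit_norm0.
move=> /eqP x0 /eqP y0; rewrite eq_le ultralimit_norm_ge0 andbT.
by rewrite (le_trans (ultralimit_normD _ _))// ultralimit_normN x0 y0 addr0.
Qed.

HB.instance Definition _ :=
  GRing.isZmodClosed.Build (bseq E) ultranull ultranull_zmod_closed.

Definition ultraproduct : Type := {ideal_quot ultranull}.

HB.instance Definition _ := GRing.Zmodule.on ultraproduct.
HB.instance Definition _ := EqQuotient.on ultraproduct.

Definition ultraclass (x : bseq E) : ultraproduct := \pi_ultraproduct x.

Lemma ultraclassP x y :
  (ultraclass x = ultraclass y) <-> ultralimit_norm (x - y) = 0.
Proof.
have := Quotient.idealrBE ultranull x y; rewrite inE => e.
split=> [xy|/eqP]; first by apply/eqP; rewrite e; exact/eqP.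
by rewrite e => /eqP.
Qed.

Lemma ultraclass_repr (q : ultraproduct) : ultraclass (repr q) = q.
Proof. exact: reprK. Qed.

Lemma ultraclassD x y : ultraclass (x + y) = ultraclass x + ultraclass y.
Proof. by rewrite /ultraclass; exact: Quotient.pi_add. Qed.

Lemma ultraclassN x : ultraclass (- x) = - ultraclass x.
Proof. by rewrite /ultraclass; exact: Quotient.pi_opp. Qed.

Definition ultrascale (k : R) (q : ultraproduct) : ultraproduct :=
  ultraclass (k *: repr q).

Definition ultranorm (q : ultraproduct) : R := ultralimit_norm (repr q).

Lemma ultrascale_class k x : ultrascale k (ultraclass x) = ultraclass (k *: x).
Proof.
apply/ultraclassP; rewrite -scalerBr ultralimit_normZ.
by rewrite (iffLR (ultraclassP _ _) (ultraclass_repr _)) mulr0.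
Qed.

Lemma ultranorm_class x : ultranorm (ultraclass x) = ultralimit_norm x.
Proof.
have /ultraclassP e := ultraclass_repr (ultraclass x).
rewrite /ultranorm; set y := repr _ in e *.
apply/eqP; rewrite eq_le; apply/andP; split.
  by rewrite -{1}(subrK x y) (le_trans (ultralimit_normD _ _))// e add0r.
rewrite -{1}(subrK y x) (le_trans (ultralimit_normD _ _))//.
by rewrite -opprB ultralimit_normN e add0r.
Qed.

Fact ultrascaleA k l q : ultrascale k (ultrascale l q) = ultrascale (k * l) q.
Proof. by rewrite -(ultraclass_repr q) !ultrascale_class scalerA. Qed.
Fact ultrascale1 : left_id 1 ultrascale.
Proof. by move=> q; rewrite -(ultraclass_repr q) ultrascale_class scale1r. Qed.
Fact ultrascaleDr : right_distributive ultrascale +%R.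
Proof.
move=> k p q; rewrite -(ultraclass_repr p) -(ultraclass_repr q).
by rewrite -ultraclassD !ultrascale_class scalerDr ultraclassD.
Qed.
Fact ultrascaleDl q : {morph ultrascale^~ q : k l / k + l}.
Proof.
move=> k l; rewrite -(ultraclass_repr q).
by rewrite !ultrascale_class scalerDl ultraclassD.
Qed.

HB.instance Definition _ := GRing.Zmodule_isLmodule.Build R ultraproduct
  ultrascaleA ultrascale1 ultrascaleDr ultrascaleDl.

Fact ultranormD p q : ultranorm (p + q) <= ultranorm p + ultranorm q.
Proof.
rewrite -(ultraclass_repr p) -(ultraclass_repr q) -ultraclassD.
by rewrite !ultranorm_class ultralimit_normD.
Qed.
Fact ultranormZ (k : R) (q : ultraproduct) :
  ultranorm (k *: q) = `|k| * ultranorm q.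
Proof.
rewrite -(ultraclass_repr q) [_ *: _]ultrascale_class.
by rewrite !ultranorm_class ultralimit_normZ.
Qed.
Fact ultranorm0_eq0 q : ultranorm q = 0 -> q = 0.
Proof.
rewrite -(ultraclass_repr q) ultranorm_class => q0.
have -> : 0 = ultraclass 0 by rewrite -[in RHS](subrr 0) ultraclassD ultraclassN subrr.
by apply/ultraclassP; rewrite subr0.
Qed.

HB.instance Definition _ := Lmodule_isNormed.Build R ultraproduct
  ultranormD ultranormZ ultranorm0_eq0.

Lemma norm_ultraclass x : `|ultraclass x| = ultralimit_norm x.
Proof. exact: ultranorm_class. Qed.

Lemma ultraclassZ k x : ultraclass (k *: x) = k *: ultraclass x.
Proof. by rewrite -ultrascale_class. Qed.

Lemma ultra_lift_small (q : ultraproduct) (e : R) : `|q| < e ->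
  exists2 x : bseq E, ultraclass x = q & forall n, `|x n| <= e.
Proof.
move=> qe; have e0 : 0 < e := le_lt_trans (normr_ge0 q) qe.
set y := repr q.
pose f n : E n := if `|y n| <= e then y n else 0.
have fe n : `|f n| <= e by rewrite /f; case: ifP => // _; rewrite normr0 ltW.
exists (BSeq (ex_intro _ e fe)) => //.
rewrite -(ultraclass_repr q); apply/ultraclassP.
apply: (cvg_lim (@norm_hausdorff _ _)); apply: cvg_near_cst.
have ye : ultralimit_norm y < e by rewrite -norm_ultraclass ultraclass_repr.
have /cvgr_le/(_ _ ye) := ultralimit_norm_cvg y; apply: filterS => n yn.
by rewrite bseqDE bseqNE /= /f yn subrr normr0.
Qed.

Fact ultraproduct_complete (F : set_system ultraproduct) :
  ProperFilter F -> cauchy F -> cvg F.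
Proof.
move=> FF /cauchyP Fc.
pose r k : R := 2^-1 ^+ k.
have r0 k : 0 < r k by rewrite exprn_gt0// invr_gt0.
have rS k : r k.+1 = r k / 2 by rewrite /r exprSr.
have /choice [x xF] k : exists x : ultraproduct, F (ball x (r k / 4)).
  by apply: Fc; rewrite divr_gt0.
have xx k : `|x k.+1 - x k| < r k.
  have [q [/= yk yk1]] := filter_ex (filterI (xF k) (xF k.+1)).
  move: yk yk1; rewrite -!ball_normE /= => yk yk1.
  rewrite -(subrK q (x k.+1)) -addrA (le_lt_trans (ler_normD _ _))//.
  by rewrite -(opprB (x k) q) normrN; have := rS k; have := r0 k; lra.
have /choice [z zP] k : exists z : bseq E,
    ultraclass z = x k.+1 - x k /\ forall n, `|z n| <= r k.
  by have [z ? ?] := ultra_lift_small (xx k); exists z.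
pose s k : bseq E := repr (x 0) + \sum_(i < k) z i.
have sx k : ultraclass (s k) = x k.
  elim: k => [|k IH]; first by rewrite /s big_ord0 addr0 ultraclass_repr.
  rewrite /s big_ord_recr/= addrA ultraclassD -/(s k) IH (zP k).1.
  by rewrite addrC subrK.
have ss n k m : `|s (k + m)%N n - s k n| <= 2 * r k - 2 * r (k + m)%N.
  elim: m => [|m IH]; first by rewrite addn0 !subrr normr0.
  rewrite addnS.
  have -> : s (k + m).+1 n = s (k + m)%N n + z (k + m)%N n.
    by rewrite /s big_ord_recr addrA bseqDE.
  rewrite addrAC (le_trans (ler_normD _ _))//.
  by have := (zP (k + m)%N).2 n; have := rS (k + m)%N; lra.
have scvg n : cvg (s k n @[k --> \oo]).
  suff : cvgn (series (fun i => z i n)).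
    move=> zc; apply: (cvgP (repr (x 0) n + lim (series (fun i => z i n) @ \oo))).
    rewrite (_ : (fun k => s k n) =
      (fun k => repr (x 0) n + series (fun i => z i n) k)); last first.
      by apply/funext => k; rewrite /s bseqDE bseq_sumE /series/= big_mkord.
    by apply: cvgD => //; exact: cvg_cst.
  apply: normed_cvg.
  apply: (@series_le_cvg _ _ (geometric 1 2^-1)) => [i|i|i|] //=.
  - by rewrite mul1r; exact: (zP i).2.
  - by apply: is_cvg_geometric_series; rewrite ger0_norm ?invr_ge0//; lra.
pose t n : E n := lim (s k n @[k --> \oo]).
have ts n k : `|t n - s k n| <= 2 * r k.
  have c : `|s i n - s k n| @[i --> \oo] --> `|t n - s k n|.
    by apply: cvg_norm; apply: cvgB; [exact: scvg|exact: cvg_cst].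
  apply: (cvgr_to_le c); exists k => // i /= ki.
  by rewrite -(subnKC ki) (le_trans (ss _ _ _))// gerBl mulr_ge0// ltW.
have tb : exists M : R, forall n, `|t n| <= M.
  have [M sM] := bseq_bounded (s 0); exists (2 * r 0 + M) => n.
  by rewrite -(subrK (s 0 n) (t n)) (le_trans (ler_normD _ _))// lerD.
pose T := BSeq tb.
apply: (cvgP (ultraclass T)); apply/cvgrPdist_lt => e e0.
have : geometric 1 2^-1 @ \oo --> (0 : R).
  by apply: cvg_geometric; rewrite ger0_norm ?invr_ge0//; lra.
move=> /cvgrPdist_lt/(_ (e / 4)) [|k _ /(_ k (leqnn k))/=]; first lra.
rewrite mul1r sub0r normrN ger0_norm ?exprn_ge0 ?invr_ge0// -/(r k) => rk.
have := xF k; apply: filterS => q; rewrite -ball_normE/= => xq.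
rewrite -(subrK (x k) (ultraclass T)) -addrA (le_lt_trans (ler_normD _ _))//.
have : `|ultraclass T - x k| <= 2 * r k.
  rewrite -sx -ultraclassN -ultraclassD norm_ultraclass.
  by apply: ultralimit_norm_le => n; exact: ts.
by have := r0 k; lra.
Qed.

HB.instance Definition _ :=
  Uniform_isComplete.Build ultraproduct ultraproduct_complete.

End UltraLimit.

Definition closed_under_ultraproducts (R : realType)
    (U : nonprincipal_ultrafilter) (EE : completeNormedModType R -> Prop) :
    Prop :=
  forall E : nat -> completeNormedModType R,
    (forall n, EE (E n)) -> EE (ultraproduct U E : completeNormedModType R).

(* Main.v *)
Require Import Defs.
From HB Require Import structures.
From Stdlib Require Import Relation_Operators.
From mathcomp Require Import all_boot all_order all_algebra.
From mathcomp Require Import all_classical all_reals all_analysis.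
From mathcomp Require Import lra.

(** The idea is to compare, over all actions of [G] on the given class of spaces
    that have no almost fixed points, the distances between points fixed by
    [Hp v] and points fixed by [Hm v], and to study a pair for which this
    distance is as small as possible.

    An action without fixed point yields, by recentring at almost minima of the
    displacement and rescaling, an ultraproduct action whose displacement is
    bounded below ([displaced_exists]). Such actions are stable under
    ultraproducts of recentred sequences, so the least distance is attained
    ([realizer_exists]): at some action there is a pair [(x, y)], called a
    realizer for [v]. Two convexity and rigidity facts make it useful.

    First, an element [n] of [N v] maps the realizer to another pair of fixed
    points at the same distance. By strict convexity the two pairs are parallel:
    [n x - x = n y - y]. This vector is invariant under the linear parts of
    [Hp v] and of [Hm v], hence of [G]. So [Hp v] and [N v] both move [x] by
    invariant translations only, and the elements doing so form a subgroup
    ([realizer_translators], [translators_subgroup]).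

    Second, an element that translates [x] by an invariant vector and has a
    fixed point anywhere fixes [x], since its orbits are bounded
    ([translator_fixed]). For [u] adjacent to [v] this makes [(x, y)] a pair of
    fixed points for [Hp u] and [Hm u]; exchanging [u] and [v] shows that the
    least distances agree, so [(x, y)] is a realizer for [u] as well and, by
    connectedness, for every vertex.

    Hence the whole group moves [x] by invariant translations, which gives a
    homomorphism from [G] to a torsion-free abelian group. It is trivial because
    the abelianization is finite ([all_translators_fixed]), so [x] is a fixed
    point, against the lower bound on the displacement. Working modulo invariant
    vectors in this way avoids splitting them off by an equivariant projection.

    The class of all uniformly convex spaces is not closed under ultraproducts,
    but the subclass with a prescribed modulus is, once the modulus is phrased on
    all balls ([ball_modulus]); each space lies in such a subclass. *)

Local Open Scope classical_set_scope.

Section FixedPointSynthesis.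

Set Implicit Arguments.
Unset Strict Implicit.

Import Order.TTheory GRing.Theory Num.Theory.
Import numFieldNormedType.Exports.
Local Open Scope ring_scope.

Variable R : realType.

(** * Affine isometries *)

(** The linear part is determined by the map, so affinity can be checked on the
    map alone; this is what ultraproducts and rescalings preserve visibly. *)
Lemma affine_isometryP (E : completeNormedModType R) (f : E -> E) :
  affine_isometry f <->
  (forall x y, `|f x - f y| = `|x - y|) /\
  (forall k x y z, f (z + k *: (x - y)) = f z + k *: (f x - f y)).
Proof.
split=> [[L [b [Liso fE]]]|[fiso faff]].
  have fB x y : f x - f y = L (x - y) by rewrite !fE opprD addrACA subrr addr0 linearB.
  by split=> [x y|k x y z]; rewrite fB ?Liso// !fE linearD linearZ addrAC.
have Llin : linear (fun x => f x - f 0).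
  move=> k u v; have := faff k u 0 v; rewrite subr0 /= [k *: u + v]addrC => ->.
  by rewrite addrAC addrC.
pose L : {linear E -> E} :=
  HB.pack (fun x => f x - f 0) (GRing.isLinear.Build R E E *:%R _ Llin).
exists L, (f 0); split=> x /=; last by rewrite subrK.
by rewrite fiso subr0.
Qed.

(** * Affine isometric actions *)

Section Action.
Variables (G : groupType) (E : completeNormedModType R).
Implicit Types (a : G -> E -> E) (g h : G) (x y z w : E).

Lemma generated_subset (A B : set G) : subgroup B -> A `<=` B ->
  generated A `<=` B.
Proof. exact: smallest_sub. Qed.

Section Theory.
Variables (a : G -> E -> E) (aP : affine_isometric_action a).

Lemma act1 x : a 1%g x = x. Proof. by case: aP. Qed.
Lemma actM g h x : a (g * h)%g x = a g (a h x). Proof. by case: aP. Qed.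

Lemma actK g x : a g^-1%g (a g x) = x.
Proof. by rewrite -actM mulVg act1. Qed.

Lemma act_dist g x y : `|a g x - a g y| = `|x - y|.
Proof. by case: aP => /(_ g)/affine_isometryP[]. Qed.

Lemma act_affine g k x y z :
  a g (z + k *: (x - y)) = a g z + k *: (a g x - a g y).
Proof. by case: aP => /(_ g)/affine_isometryP[]. Qed.

Lemma act_add g x y z : a g (z + (x - y)) = a g z + (a g x - a g y).
Proof. by have := act_affine g 1 x y z; rewrite !scale1r. Qed.

Lemma stabilizer_subgroup x : subgroup [set g | a g x = x].
Proof.
split=> [|g h /= gx hx|g /= gx]; first exact: act1.
  by rewrite actM hx.
by rewrite -{1}gx actK.
Qed.

Lemma fixed_generated (A : set G) x : generated A = setT ->
  fixed_point a A x -> fixed_point a setT x.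
Proof.
move=> AG Ax g _; have : generated A g by rewrite AG.
exact: (generated_subset (stabilizer_subgroup x)).
Qed.

(** The vectors fixed by the linear part of [a] are those along which
    translation commutes with the whole action; in this form no linear part
    has to be chosen. *)
Definition invariant_vector w := forall g z, a g (z + w) = a g z + w.

Lemma invariant_vector0 : invariant_vector 0.
Proof. by move=> g z; rewrite !addr0. Qed.

Lemma invariant_vectorD w1 w2 : invariant_vector w1 -> invariant_vector w2 ->
  invariant_vector (w1 + w2).
Proof. by move=> w1P w2P g z; rewrite !addrA w2P w1P. Qed.

Lemma invariant_vectorN w : invariant_vector w -> invariant_vector (- w).
Proof. by move=> wP g z; rewrite -{2}(subrK w z) wP addrK. Qed.

(** The elements that act on [x] as an invariant translation. They preserve
    the fibre of [x] modulo the invariant vectors, hence form a subgroup. *)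
Definition translators x : set G := [set g | invariant_vector (a g x - x)].

Lemma translator_act x g : a g x = x + (a g x - x).
Proof. by rewrite addrC subrK. Qed.

Lemma translatorM x g h : translators x h ->
  a (g * h)%g x - x = (a g x - x) + (a h x - x).
Proof. by move=> hx; rewrite actM {1}(translator_act x h) hx addrAC. Qed.

Lemma translatorV x g : translators x g -> a g^-1%g x - x = - (a g x - x).
Proof.
move=> gx; apply/eqP; rewrite -addr_eq0 -translatorM//.
by rewrite mulVg act1 subrr.
Qed.

Lemma translators_subgroup x : subgroup (translators x).
Proof.
split=> [|g h gx hx|g gx].
- by rewrite /translators/= act1 subrr; exact: invariant_vector0.
- by rewrite /translators/= translatorM//; exact: invariant_vectorD.
- by rewrite /translators/= translatorV//; exact: invariant_vectorN.
Qed.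

Lemma translatorX x g n : translators x g ->
  a (g ^+ n)%g x - x = (a g x - x) *+ n.
Proof.
move=> gx; elim: n => [|n IH]; first by rewrite expg0 act1 subrr.
by rewrite expgSr translatorM// IH -mulrSr.
Qed.

(** The powers of a translator move [x] linearly far, whereas an element with
    a fixed point has bounded orbits. *)
Lemma translator_fixed x z g : translators x g -> a g z = z -> a g x = x.
Proof.
move=> gx gz; apply/eqP; rewrite -subr_eq0 -normr_le0 leNgt; apply/negP => w0.
have gnz n : a (g ^+ n)%g z = z.
  by elim: n => [|n IH]; rewrite ?expg0 ?act1// expgS actM IH.
have bound n : `|a g x - x| *+ n <= 2 * `|x - z|.
  rewrite -normrMn -translatorX// -{1}(subrK z (a _ x)) -addrA.
  rewrite (le_trans (ler_normD _ _))// -{1}(gnz n) act_dist (distrC z x).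
  lra.
have := archi_boundP (divr_ge0 (mulr_ge0 (ler0n R 2) (normr_ge0 (x - z))) (ltW w0)).
by rewrite ltr_pdivrMr// [X in _ < X]mulr_natl ltNge bound.
Qed.

(** If every element translates [x], then the translation vectors form a
    homomorphism to a torsion-free abelian group; it factors through the finite
    abelianization and vanishes. *)
Lemma all_translators_fixed x : finite_abelianization G ->
  translators x = setT -> fixed_point a setT x.
Proof.
move=> Gfin xG g _; have tr h : translators x h by rewrite xG.
pose c h := a h x - x.
have cM h k : c (h * k)%g = c h + c k by rewrite /c translatorM.
have c1 : c 1%g = 0 by rewrite /c act1 subrr.
have cV h : c h^-1%g = - c h by rewrite /c translatorV.
have cX h n : c (h ^+ n)%g = c h *+ n by rewrite /c translatorX.
have ker : commutator_subgroup (G:=G) `<=` [set h | c h = 0].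
  apply: generated_subset => [|_ [h [k ->]]].
    split=> [//|h k /= h0 k0|h /= h0]; first by rewrite cM h0 k0 addr0.
    by rewrite cV h0 oppr0.
  rewrite /= commgEl conjgE !cM !cV.
  by rewrite (addrCA (- c k)) addNr addr0 addNr.
apply/eqP; rewrite -subr_eq0; apply: contrapT => /negP cg0.
apply: infinite_nat.
have inj : injective (fun n => lcoset (commutator_subgroup (G:=G)) (g ^+ n)%g).
  move=> m n mn.
  have [h hker] : lcoset (commutator_subgroup (G:=G)) (g ^+ n)%g (g ^+ m)%g.
    rewrite -mn; exists 1%g; last by rewrite mulg1.
    by move=> B [[]].
  move=> /(congr1 c); rewrite cM (ker _ hker) addr0 !cX -[c g]scale1r.
  move=> /eqP; rewrite !scalerMnl -subr_eq0 -scalerBl scaler_eq0 (negbTE cg0) orbF.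
  by rewrite subr_eq0 eqr_nat => /eqP.
have := finite_preimage (in2W inj) Gfin.
by apply: sub_finite_set => n _ /=; exists (g ^+ n)%g.
Qed.

End Theory.
End Action.

(** * Displacement *)

(** Summing over the generators, rather than taking a maximum, lets the
    displacement pass to ultralimits term by term. *)
Definition displacement (G : groupType) (S : seq G)
    (E : completeNormedModType R) (a : G -> E -> E) (x : E) : R :=
  \sum_(s <- S) `|a s x - x|.

Section Displacement.
Variables (G : groupType) (S : seq G) (E : completeNormedModType R).
Variables (a : G -> E -> E) (aP : affine_isometric_action a).
Implicit Types x y : E.

Lemma le_displacement x s : s \in S -> `|a s x - x| <= displacement S a x.
Proof.
rewrite /displacement => sS; rewrite (big_rem s sS)/= lerDl.
exact: sumr_ge0.
Qed.

Lemma displacement_fixed x : generated [set` S] = setT ->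
  displacement S a x <= 0 -> fixed_point a setT x.
Proof.
move=> SG x0; apply: (fixed_generated aP SG) => s /= sS.
apply/eqP; rewrite -subr_eq0 -normr_le0.
exact: le_trans (le_displacement x sS) x0.
Qed.

Lemma displacement_lipschitz x y :
  displacement S a x <= displacement S a y + (2 * (size S)%:R) * `|x - y|.
Proof.
rewrite /displacement; elim: S => [|s s' IH].
  by rewrite !big_nil mulr0 mul0r addr0.
rewrite !big_cons /=.
have : `|a s x - x| <= `|a s y - y| + 2 * `|x - y|.
  have -> : a s x - x = (a s x - a s y) + (a s y - y) + (y - x).
    by rewrite !addrA !subrK.
  rewrite (le_trans (ler_normD _ _))// (distrC y x).
  have := ler_normD (a s x - a s y) (a s y - y); rewrite act_dist//; lra.
by move: IH; rewrite -natr1; lra.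
Qed.

Definition rescale (p : E) (c : R) : G -> E -> E :=
  fun g z => c^-1 *: (a g (p + c *: z) - p).

Variables (p : E) (c : R) (c0 : 0 < c).

Lemma rescaleE g z : p + c *: rescale p c g z = a g (p + c *: z).
Proof. by rewrite /rescale scalerA divff ?gt_eqF// scale1r addrC subrK. Qed.

Lemma rescale_action : affine_isometric_action (rescale p c).
Proof.
have inj y z : p + c *: y = p + c *: z -> y = z.
  by move/addrI/(scalerI (lt0r_neq0 c0)).
split=> [g|z|g h z].
- apply/affine_isometryP; split=> [y z|k x y z].
    rewrite /rescale -scalerBr normrZ opprB addrA subrK act_dist//.
    rewrite opprD addrACA subrr add0r -scalerBr normrZ mulrA -normrM.
    by rewrite mulVf ?gt_eqF// normr1 mul1r.
  apply: inj; rewrite rescaleE [in RHS]scalerDr [in RHS]addrA rescaleE.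
  rewrite [in RHS]scalerA [in RHS]mulrC -[in RHS]scalerA [in RHS]scalerBr.
  have -> : c *: rescale p c g x - c *: rescale p c g y =
      a g (p + c *: x) - a g (p + c *: y).
    by rewrite -!rescaleE opprD addrACA subrr add0r.
  rewrite -(act_affine aP) opprD addrACA subrr add0r; congr (a g _).
  by rewrite scalerDr addrA scalerA mulrC -scalerA scalerBr.
- by apply: inj; rewrite rescaleE (act1 aP).
- by apply: inj; rewrite !rescaleE (actM aP).
Qed.

Lemma displacement_rescale z :
  displacement S (rescale p c) z = c^-1 * displacement S a (p + c *: z).
Proof.
rewrite /displacement mulr_sumr; apply: eq_bigr => s _.
have -> : rescale p c s z - z = c^-1 *: (a s (p + c *: z) - (p + c *: z)).
  rewrite /rescale opprD addrA [in RHS]scalerBr.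
  by rewrite scalerA mulVf ?gt_eqF// scale1r.
by rewrite normrZ gtr0_norm// invr_gt0.
Qed.

End Displacement.

(** If the conclusion fails, each point has one within [c] times its value where
    [f] is less than half as large; iterating gives a Cauchy sequence, whose limit
    is a zero of [f]. *)
Lemma almost_minimum (E : completeNormedModType R) (f : E -> R) (K c : R) :
  0 <= c -> (forall x, 0 < f x) -> (forall x y, f x <= f y + K * `|x - y|) ->
  exists x, forall y, `|y - x| <= c * f x -> f x / 2 <= f y.
Proof.
move=> c0 f0 flip; apply: contrapT => /forallNP nmin.
have /choice[F FP] x : exists y, `|y - x| <= c * f x /\ f y < f x / 2.
  have /existsNP[y /not_implyP[yx /negP]] := nmin x.
  by rewrite -ltNge; exists y.
pose u n := iter n F 0.
have fu n : f (u n) <= geometric (f 0) 2^-1 n.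
  elim: n => [|n IH] /=; first by rewrite expr0 mulr1.
  have := (FP (u n)).2; rewrite exprS; move: IH => /=; lra.
have ucvg : cvg (u n @[n --> \oo]).
  suff sc : cvgn (series (fun n => u n.+1 - u n)).
    rewrite (_ : u = fun n => u 0%N + series (fun n => u n.+1 - u n) n).
      by apply: is_cvgD => //; exact: is_cvg_cst.
    by apply/funext => n; rewrite /series/= telescope_sumr// addrC subrK.
  apply: normed_cvg.
  apply: (@series_le_cvg _ _ (geometric (c * f 0) 2^-1)) => [n|n|n|] //=.
  - by rewrite mulr_ge0 ?exprn_ge0// mulr_ge0// ltW.
  - by rewrite -mulrA (le_trans (FP (u n)).1)// ler_wpM2l//; exact: fu.
  - by apply: is_cvg_geometric_series; rewrite ger0_norm ?invr_ge0//; lra.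
set l := lim (u n @[n --> \oo]) in ucvg.
have gap : geometric (f 0) 2^-1 n + K * `|l - u n| @[n --> \oo] -->
    0 + K * `|l - l|.
  apply: cvgD.
    by apply: cvg_geometric; rewrite ger0_norm ?invr_ge0//; lra.
  by apply: cvgMr; apply: cvg_norm; apply: cvgB => //; exact: cvg_cst.
have : f l <= 0 + K * `|l - l|.
  apply: (ler_cvg_to (cvg_cst (f l)) gap); apply: nearW => n.
  by rewrite (le_trans (flip l (u n)))// lerD2r; exact: fu.
by rewrite subrr normr0 mulr0 addr0 leNgt f0.
Qed.

(** * Ultraproducts of actions *)

(** A sequence of actions is put on the ultraproduct coordinatewise, with the
    origins as base points. *)
Section Ultraproduct.
Variables (U : nonprincipal_ultrafilter) (G : groupType).
Variable E : nat -> completeNormedModType R.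
Variable a : forall n, G -> E n -> E n.
Arguments a : clear implicits.
Hypothesis aP : forall n, affine_isometric_action (a n).

Lemma ultrafilter_ge m : (ultrafilter_sets U) [set n | (m <= n)%N].
Proof.
elim: m => [|m IH]; first exact: filterE.
have nm : (ultrafilter_sets U) (~` [set m]).
  have [mU|//] := in_ultra_setVsetC [set m] (ultrafilter_ultra U).
  by have := ultrafilter_nonprincipal mU.
apply: filterS (filterI IH nm) => n /= [mn /eqP].
by rewrite ltn_neqAle eq_sym => -> /=.
Qed.

(** The elements that move the origins by a bounded amount form a subgroup. *)
Lemma bounded_orbits (A : set G) : generated A = setT ->
  (forall s, A s -> exists M : R, forall n, `|a n s 0| <= M) ->
  forall g, exists M : R, forall n, `|a n g 0| <= M.
Proof.
move=> AG bA g; have : generated A g by rewrite AG.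
apply: (generated_subset (B := [set g | exists M : R, forall n, `|a n g 0| <= M]))
  => //; split.
- by exists 0 => n; rewrite (act1 (aP n)) normr0.
- move=> {}g h [M gM] [N hN]; exists (M + N) => n.
  rewrite (actM (aP n)) -(subrK (a n g 0) (a n g _)) addrC.
  rewrite (le_trans (ler_normD _ _))// lerD// (act_dist (aP n)).
  by rewrite subr0.
- move=> {}g [M gM]; exists M => n.
  by rewrite -[X in X <= _]normrN -[- _]add0r -{1}(actK (aP n) g 0) (act_dist (aP n)) subr0.
Qed.

Hypothesis a_bounded : forall g, exists M : R, forall n, `|a n g 0| <= M.

Fact bseq_act_bounded g (x : Defs.bseq E) : exists M : R, forall n, `|a n g (x n)| <= M.
Proof.
have [M aM] := a_bounded g; have [N xN] := bseq_bounded x.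
exists (N + M) => n; rewrite -(subrK (a n g 0) (a n g _)).
by rewrite (le_trans (ler_normD _ _))// lerD// (act_dist (aP n)) subr0.
Qed.

Definition bseq_act g x := BSeq (bseq_act_bounded g x).

Definition ultra_act g (q : ultraproduct U E) : ultraproduct U E :=
  ultraclass U (bseq_act g (repr q)).

Lemma bseq_act_dist g x y :
  ultralimit_norm U (bseq_act g x - bseq_act g y) = ultralimit_norm U (x - y).
Proof.
rewrite /ultralimit_norm.
suff -> : (fun n => `|(bseq_act g x - bseq_act g y) n|) =
  (fun n => `|(x - y) n|) by [].
by apply/funext => n; rewrite !bseqDE !bseqNE /= (act_dist (aP n)).
Qed.

Lemma ultra_act_class g x :
  ultra_act g (ultraclass U x) = ultraclass U (bseq_act g x).
Proof.
apply/(ultraclassP U); rewrite bseq_act_dist.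
by apply/(ultraclassP U); rewrite ultraclass_repr.
Qed.

Lemma ultra_act_fixed (H : set G) (x : Defs.bseq E) :
  (forall n, fixed_point (a n) H (x n)) ->
  fixed_point ultra_act H (ultraclass U x).
Proof.
move=> xH h Hh; rewrite ultra_act_class; congr ultraclass.
by apply: Defs.bseqP => n; exact: xH.
Qed.

Lemma ultraclass_surj (q : ultraproduct U E) : exists x, ultraclass U x = q.
Proof. by exists (repr q); exact: ultraclass_repr. Qed.

Lemma ultra_act_action :
  affine_isometric_action (E := ultraproduct U E : completeNormedModType R) ultra_act.
Proof.
split=> [g|q|g h q].
- apply/affine_isometryP; split=> [p q|k p q r].
    rewrite -(ultraclass_repr p) -(ultraclass_repr q) !ultra_act_class.
    by rewrite -!ultraclassN -!ultraclassD !norm_ultraclass bseq_act_dist.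
  have [x <-] := ultraclass_surj p; have [y <-] := ultraclass_surj q.
  have [z <-] := ultraclass_surj r.
  have aff x' y' z' : ultraclass U z' + k *: (ultraclass U x' - ultraclass U y') =
      ultraclass U (z' + k *: (x' - y')).
    by rewrite ultraclassD ultraclassZ ultraclassD ultraclassN.
  rewrite !ultra_act_class !aff ultra_act_class; congr ultraclass.
  by apply: Defs.bseqP => n; exact: (act_affine (aP n)).
- rewrite -(ultraclass_repr q) ultra_act_class; congr ultraclass.
  by apply: Defs.bseqP => n /=; exact: (act1 (aP n)).
- rewrite -(ultraclass_repr q) !ultra_act_class; congr ultraclass.
  by apply: Defs.bseqP => n /=; exact: (actM (aP n)).
Qed.

Lemma displacement_ultra_act (S : seq G) (d : R) :
  (forall M : R, \forall n \near ultrafilter_sets U,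
     forall z : E n, `|z| <= M -> d <= displacement S (a n) z) ->
  forall q, d <= displacement S
    (E := ultraproduct U E : completeNormedModType R) ultra_act q.
Proof.
move=> dS q; rewrite -(ultraclass_repr q); set x := repr q.
have c : displacement S (a n) (x n) @[n --> ultrafilter_sets U] -->
   displacement S (E := ultraproduct U E : completeNormedModType R)
     ultra_act (ultraclass U x).
  rewrite /displacement; elim: S {dS} => [|s S' IH].
    under eq_fun do rewrite big_nil.
    by rewrite big_nil; exact: cvg_cst.
  under eq_fun do rewrite big_cons.
  rewrite big_cons; apply: cvgD => //.
  rewrite ultra_act_class -ultraclassN -ultraclassD norm_ultraclass.
  exact: ultralimit_norm_cvg.
have [M xM] := bseq_bounded x.
apply: (cvgr_to_ge c).
by apply: filterS (dS M) => n; apply.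
Qed.

End Ultraproduct.

(** * Actions without almost fixed points *)

Definition strictly_convex (E : completeNormedModType R) : Prop :=
  forall x y : E, `|y| = `|x| -> `|x| <= `|2^-1 *: (x + y)| -> x = y.

Lemma midpointE (E : completeNormedModType R) (x y : E) :
  x + 2^-1 *: (y - x) = 2^-1 *: (x + y).
Proof.
rewrite scalerBr scalerDr addrCA addrC; congr (_ + _).
by rewrite -{1}(scale1r x) -scalerBl; congr (_ *: _); lra.
Qed.

Lemma rescale_fixed (G : groupType) (E : completeNormedModType R)
    (a : G -> E -> E) (K : set G) (p : E) (c : R) (z : E) : 0 < c ->
  fixed_point a K (p + c *: z) -> fixed_point (rescale a p c) K z.
Proof.
move=> c0 zK k Kk; rewrite /rescale zK// [p + _]addrC addrK scalerA.
by rewrite mulVf ?gt_eqF// scale1r.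
Qed.

Section Gap.
Variables (U : nonprincipal_ultrafilter) (G : groupType) (S : seq G).
Hypothesis SG : generated [set` S] = setT.
Variable C : completeNormedModType R -> Prop.
Hypothesis C_ultra : closed_under_ultraproducts U C.

(** The bound 1/2 is what an almost minimum guarantees after normalizing the
    displacement there to 1. *)
Definition displaced (E : completeNormedModType R) (a : G -> E -> E) : Prop :=
  [/\ C E, affine_isometric_action a & forall x, 2^-1 <= displacement S a x].

(** Around an almost minimum [p n] of the displacement [f], at radius
    [n * f (p n)], the displacement is at least half of its value at [p n]. After
    recentring and rescaling by [f (p n)] the radius tends to infinity and the
    displacement at the origin is 1, so the ultraproduct of these actions exists
    and inherits the lower bound at every point. *)
Lemma displaced_exists (E : completeNormedModType R) (a : G -> E -> E) :
  C E -> affine_isometric_action a -> ~ (exists x, fixed_point a setT x) ->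
  exists (F : completeNormedModType R) (b : G -> F -> F), displaced b.
Proof.
move=> CE aP nfix; pose f := displacement S a.
have f0 x : 0 < f x.
  rewrite ltNge; apply/negP => x0; apply: nfix; exists x.
  exact: displacement_fixed SG x0.
have /choice[p pP] n : exists p, forall y, `|y - p| <= n%:R * f p -> f p / 2 <= f y.
  exact: almost_minimum (displacement_lipschitz S aP).
pose b n := rescale a (p n) (f (p n)).
have bP n : affine_isometric_action (b n) by exact: rescale_action.
have bdisp n z : displacement S (b n) z = (f (p n))^-1 * f (p n + f (p n) *: z).
  exact: displacement_rescale.
have bb g : exists M : R, forall n, `|b n g 0| <= M.
  apply: (bounded_orbits bP SG) => s sS; exists 1 => n.
  rewrite -[b n s 0]subr0 (le_trans (le_displacement _ _ sS))//.
  by rewrite bdisp scaler0 addr0 mulVf// gt_eqF.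
exists (ultraproduct U (fun=> E) : completeNormedModType R), (ultra_act bP bb).
split; [exact: C_ultra|exact: ultra_act_action|].
apply: displacement_ultra_act => M.
apply: filterS (ultrafilter_ge U (Num.bound `|M|)) => n /= Mn z zM.
rewrite bdisp mulrC ler_pdivlMr// mulrC; apply: pP.
rewrite addrAC subrr add0r normrZ gtr0_norm// mulrC.
apply: ler_wpM2r; first exact/ltW.
rewrite (le_trans zM)// (le_trans (ler_norm M))//.
by rewrite (le_trans (ltW (archi_boundP (normr_ge0 M))))// ler_nat.
Qed.

Definition gap_pair (Hp Hm : set G) (E : completeNormedModType R)
    (a : G -> E -> E) (x y : E) : Prop :=
  [/\ displaced a, fixed_point a Hp x & fixed_point a Hm y].

Definition realizer (Hp Hm : set G) (E : completeNormedModType R)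
    (a : G -> E -> E) (x y : E) : Prop :=
  gap_pair Hp Hm a x y /\
  forall (F : completeNormedModType R) (b : G -> F -> F) (x' y' : F),
    gap_pair Hp Hm b x' y' -> `|x - y| <= `|x' - y'|.

(** The data of a pair in a single type, so that sequences can be chosen. *)
Record configuration := Configuration {
  conf_space : completeNormedModType R;
  conf_act : G -> conf_space -> conf_space;
  conf_pt1 : conf_space;
  conf_pt2 : conf_space }.

Definition conf_pair Hp Hm (c : configuration) :=
  gap_pair Hp Hm (@conf_act c) (conf_pt1 c) (conf_pt2 c).

Definition conf_dist (c : configuration) : R := `|conf_pt1 c - conf_pt2 c|.

(** A minimizing sequence of pairs, each recentred at its first point, has an
    ultraproduct: the other points stay bounded, so that [Hm] moves the origin
    boundedly, while [Hp] fixes it. *)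
Lemma realizer_exists (Hp Hm : set G) : generated (Hp `|` Hm) = setT ->
  rel_property_F_class G Hp C -> rel_property_F_class G Hm C ->
  (exists (E : completeNormedModType R) (a : G -> E -> E), displaced a) ->
  exists (E : completeNormedModType R) (a : G -> E -> E) (x y : E),
    realizer Hp Hm a x y.
Proof.
move=> HG Fp Fm [E0 [a0 a0D]].
pose dists : set R :=
  [set r | exists c, conf_pair Hp Hm c /\ conf_dist c = r].
pose D := inf dists.
have dists_inf : has_inf dists.
  split; last by exists 0 => _ [c [_ <-]]; exact: normr_ge0.
  have [CE a0P _] := a0D.
  have [x xp] := Fp _ CE _ a0P; have [y ym] := Fm _ CE _ a0P.
  by exists `|x - y|, (Configuration a0 x y).
have Dle c : conf_pair Hp Hm c -> D <= conf_dist c.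
  by move=> cP; apply: ge_inf; [exact: dists_inf.2|exists c].
have /choice[c cP] n : exists c, conf_pair Hp Hm c /\ conf_dist c < D + harmonic n.
  have [|_ [c [cP <-]] cD] := inf_adherent (eps := harmonic n) _ dists_inf.
    exact: harmonic_gt0.
  by exists c.
pose E n := conf_space (c n).
pose x n : E n := conf_pt1 (c n); pose y n : E n := conf_pt2 (c n).
pose a n : G -> E n -> E n := rescale (@conf_act (c n)) (x n) 1.
have aP n : affine_isometric_action (a n).
  by apply: rescale_action => //; case: (cP n) => -[[]].
have fix0 n : fixed_point (a n) Hp 0.
  by apply: rescale_fixed => //; rewrite scaler0 addr0; case: (cP n) => -[].
have fixy n : fixed_point (a n) Hm (y n - x n).
  by apply: rescale_fixed => //; rewrite scale1r addrC subrK; case: (cP n) => -[].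
have yD n : `|y n - x n| <= D + harmonic n by rewrite distrC ltW; case: (cP n).
have yb : exists M : R, forall n, `|y n - x n| <= M.
  exists (D + 1) => n; rewrite (le_trans (yD n))// lerD2l.
  by rewrite invf_le1// ler1n.
have ab g : exists M : R, forall n, `|a n g 0| <= M.
  apply: (bounded_orbits aP HG) => s [sp|sm].
    by exists 0 => n; rewrite fix0// normr0.
  have [M yM] := yb; exists (M + M) => n.
  rewrite -(subrK (a n s (y n - x n)) (a n s 0)) (le_trans (ler_normD _ _))//.
  by rewrite (act_dist (aP n)) sub0r normrN fixy// lerD.
pose Y : Defs.bseq E := BSeq yb.
exists (ultraproduct U E : completeNormedModType R), (ultra_act aP ab).
exists (ultraclass U 0), (ultraclass U Y).
have pairP : gap_pair Hp Hm
    (E := ultraproduct U E : completeNormedModType R) (ultra_act aP ab)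
    (ultraclass U 0) (ultraclass U Y).
  split; [split|exact: ultra_act_fixed|exact: ultra_act_fixed].
  - by apply: C_ultra => n; case: (cP n) => -[[]].
  - exact: ultra_act_action.
  - apply: displacement_ultra_act => M; apply: filterE => n z _.
    rewrite displacement_rescale// invr1 mul1r.
    by case: (cP n) => -[[_ _]].
split=> // F b x' y' bP.
apply: (@le_trans _ _ D); last exact: (Dle (Configuration b x' y')).
rewrite distrC -(ultraclassN U) -(ultraclassD U) norm_ultraclass subr0.
have Dlim : (D + harmonic n) @[n --> ultrafilter_sets U] --> D + 0.
  apply: cvgD; first exact: cvg_cst.
  apply: cvg_trans (@cvg_harmonic R); apply: cvg_app => A [m _ mA].
  exact: filterS mA (ultrafilter_ge U m).
rewrite -[leRHS]addr0.
apply: (ler_cvg_to (@ultralimit_norm_cvg _ U _ Y) Dlim).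
by apply: filterE => n; exact: yD.
Qed.

Section Realizer.
Variables (Hp Hm : set G) (E : completeNormedModType R) (a : G -> E -> E).
Hypothesis E_strict : strictly_convex E.
Hypothesis HG : generated (Hp `|` Hm) = setT.

(** The elements whose linear part fixes [w] form a subgroup, and both [Hp] and
    [Hm] fix two points that differ by [w]. *)
Lemma parallel_translation_invariant (x y w : E) : affine_isometric_action a ->
  fixed_point a Hp x -> fixed_point a Hp (x + w) ->
  fixed_point a Hm y -> fixed_point a Hm (y + w) -> invariant_vector a w.
Proof.
move=> aP xp xwp ym ywm g; have : generated (Hp `|` Hm) g by rewrite HG.
apply: (generated_subset (B := [set g | forall z, a g (z + w) = a g z + w])).
  split=> [z|{}g h /= gw hw z|{}g /= gw z]; first by rewrite !(act1 aP).
    by rewrite !(actM aP) hw gw.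
  by rewrite -{1}(actK aP g^-1%g z) invgK -gw (actK aP).
have wE (t : E) : w = t + w - t by rewrite addrAC subrr add0r.
move=> h [hp|hm] z.
  by rewrite {1}(wE x) (act_add aP) xwp// xp// -wE.
by rewrite {1}(wE y) (act_add aP) ywm// ym// -wE.
Qed.

Lemma normalizes_fixed (K H : set G) (x : E) n : affine_isometric_action a ->
  normalizes K H -> K n -> fixed_point a H x -> fixed_point a H (a n x).
Proof.
move=> aP KH Kn xH h Hh.
have Hhn : H (h ^ n)%g by rewrite -(KH n Kn); exists h.
by rewrite -(actM aP) -[(h * n)%g](mulVKg n) -conjgE (actM aP) xH.
Qed.

(** The midpoint of the pair and of its image is again a pair of fixed points, so
    minimality and strict convexity force the two pairs to be parallel. *)
Lemma realizer_translators (K : set G) (x y : E) : realizer Hp Hm a x y ->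
  normalizes K Hp -> normalizes K Hm ->
  K `<=` translators a x `&` translators a y.
Proof.
move=> [[aD xp ym] xymin] Kp Km n Kn; have [_ aP _] := aD.
set x' := a n x; set y' := a n y.
have x'p : fixed_point a Hp x' by exact: normalizes_fixed Kp Kn xp.
have y'm : fixed_point a Hm y' by exact: normalizes_fixed Km Kn ym.
have midp : fixed_point a Hp (x + 2^-1 *: (x' - x)).
  by move=> h hp; rewrite (act_affine aP) x'p// xp.
have midm : fixed_point a Hm (y + 2^-1 *: (y' - y)).
  by move=> h hm; rewrite (act_affine aP) y'm// ym.
have parallel : x - y = x' - y'.
  apply: E_strict; first exact: act_dist.
  have -> : 2^-1 *: (x - y + (x' - y')) =
      x + 2^-1 *: (x' - x) - (y + 2^-1 *: (y' - y)).
    by rewrite !midpointE -scalerBr opprD addrACA.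
  by apply: (xymin E a).
have wE : y' - y = x' - x.
  have -> : x' = x - y + y' by rewrite parallel subrK.
  by rewrite [RHS]addrAC [x - y - x]addrAC subrr add0r addrC.
have winv : invariant_vector a (x' - x).
  apply: (parallel_translation_invariant (x := x) (y := y)) => //.
    by rewrite addrC subrK.
  by rewrite -wE addrC subrK.
by split; rewrite /translators/= -/x' -/y' ?wE.
Qed.

End Realizer.

End Gap.

(** * The synthesis *)

(** Closedness under ultraproducts provides pairs at the least distance; strict
    convexity makes equally short pairs parallel. *)
Theorem fixed_point_synthesis (U : nonprincipal_ultrafilter) (G : groupType)
    (C : completeNormedModType R -> Prop)
    (V : Type) (adj : V -> V -> Prop) (N Hp Hm : V -> set G) :
  finitely_generated G -> finite_abelianization G ->
  closed_under_ultraproducts U C -> (forall E, C E -> strictly_convex E) ->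
  undirected adj -> connected_graph adj ->
  (forall v, normalizes (N v) (Hp v) /\ normalizes (N v) (Hm v)) ->
  (forall v, generated (Hp v `|` Hm v) = [set: G]) ->
  (forall u v, adj u v -> Hp u `<=` generated (Hp v `|` N v) /\
                          Hm u `<=` generated (Hm v `|` N v)) ->
  generated (\bigcup_v (Hp v `|` N v)) = [set: G] ->
  (forall v, rel_property_F_class G (Hp v) C /\
             rel_property_F_class G (Hm v) C) ->
  property_F_class G C.
Proof.
move=> [A Afin AG] Gab Cultra Cstrict adjC adj_conn Nnorm Hgen adjH NHgen relF.
have [S AS] := (finite_seqP _).1 Afin; rewrite {}AS {Afin} in AG.
move=> E0 CE0 a0 a0P; apply: contrapT => nfix.
have disp := displaced_exists AG Cultra CE0 a0P nfix.
have real v := realizer_exists Cultra (Hgen v) (relF v).1 (relF v).2 disp.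
have transl v (E : completeNormedModType R) (a : G -> E -> E) (x y : E) :
    realizer S C (Hp v) (Hm v) a x y ->
    generated (Hp v `|` N v) `<=` translators a x /\
    generated (Hm v `|` N v) `<=` translators a y.
  move=> xyv; have [[[CE aP _] xp ym] _] := xyv.
  have Ntr := realizer_translators (Cstrict _ CE) (Hgen v) xyv
    (Nnorm v).1 (Nnorm v).2.
  have fix_tr z g : a g z = z -> translators a z g.
    by rewrite /translators/= => ->; rewrite subrr; exact: invariant_vector0.
  by split; apply: (generated_subset (translators_subgroup aP _)) => g [gH|/Ntr[]//];
    apply: fix_tr; [exact: xp|exact: ym].
have step u v (E : completeNormedModType R) (a : G -> E -> E) (x y : E) :
    adj u v -> realizer S C (Hp v) (Hm v) a x y ->
    gap_pair S C (Hp u) (Hm u) a x y.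
  move=> uv xyv; have [xtr ytr] := transl _ _ _ _ _ xyv.
  have [[[CE aP aD] _ _] _] := xyv; have [pu mu] := adjH _ _ uv.
  have [z zp] := (relF u).1 _ CE _ aP; have [t tm] := (relF u).2 _ CE _ aP.
  split; first by split.
    by move=> h hu; apply: (translator_fixed aP (z := z)); [apply: xtr; exact: pu|exact: zp].
  by move=> h hu; apply: (translator_fixed aP (z := t)); [apply: ytr; exact: mu|exact: tm].
have transfer u v (E : completeNormedModType R) (a : G -> E -> E) (x y : E) :
    adj u v -> realizer S C (Hp v) (Hm v) a x y -> realizer S C (Hp u) (Hm u) a x y.
  move=> uv xyv; split; first exact: step uv xyv.
  move=> F b x' y' x'y'u; have [F1 [b1 [x1 [y1 x1y1u]]]] := real u.
  apply: (le_trans _ (x1y1u.2 _ _ _ _ x'y'u)).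
  apply: xyv.2; exact: step (adjC _ _ uv) x1y1u.
(* Over an empty vertex set every pair qualifies: then [G] is trivial. *)
have [E [a [x [y [aD xall]]]]] : exists (E : completeNormedModType R)
    (a : G -> E -> E) (x y : E),
    displaced S C a /\ forall v, realizer S C (Hp v) (Hm v) a x y.
  have [[v0]|nV] := pselect (inhabited V).
    have [E [a [x [y xyv0]]]] := real v0; exists E, a, x, y.
    split; first by case: xyv0 => -[].
    move=> v; have := adj_conn v v0; move: xyv0 => /[swap] vv0.
    elim: vv0 => {v v0} [u v uv|//|u v w _ IHu _ IHv /IHv/IHu//].
    exact: transfer.
  have [E [a aD]] := disp; exists E, a, 0, 0; split=> // v.
  by case: nV.
have [_ aP adisp] := aD.
have xG : translators a x = setT.
  apply/seteqP; split=> // g _; have : generated (\bigcup_v (Hp v `|` N v)) g.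
    by rewrite NHgen.
  apply: (generated_subset (translators_subgroup aP x)) => h [v _ hv].
  by apply: (transl _ _ _ _ _ (xall v)).1; exact: sub_gen_smallest.
have xfix := all_translators_fixed aP Gab xG.
have := adisp x; rewrite /displacement big1; first by rewrite leNgt invr_gt0 ltr0n.
by move=> s _; rewrite xfix// subrr normr0.
Qed.

(** * Uniform convexity *)

(** Uniform convexity on all balls at once. The strict inequality and the
    homogeneous form make the condition pass to limits of norms, hence to
    ultraproducts, with the same modulus. *)
Definition ball_modulus (delta : R -> R) (E : completeNormedModType R) : Prop :=
  forall (eps r : R) (x y : E), 0 < eps <= 2 -> `|x| <= r -> `|y| <= r ->
    eps * r < `|x - y| -> `|2^-1 *: (x + y)| <= (1 - delta eps) * r.

Section BallModulus.
Variables (delta : R -> R).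
Hypothesis delta_bound : forall eps, 0 < eps <= 2 -> 0 < delta eps <= 1.

Lemma ball_modulus_strictly_convex (E : completeNormedModType R) :
  ball_modulus delta E -> strictly_convex E.
Proof.
move=> Ed x y yx mid; apply/eqP; rewrite -subr_eq0 -normr_le0 leNgt.
apply/negP => d0; have x0 : 0 < `|x|.
  by have := ler_normB x y; rewrite yx; lra.
have q0 : 0 < `|x - y| / `|x| by rewrite divr_gt0.
pose eps := Num.min 2 (`|x - y| / `|x| / 2).
have e2 : 0 < eps <= 2 by rewrite lt_min ge_min lexx ltr0n/= andbT; lra.
have [de0 _] := andP (delta_bound e2).
have ed : eps * `|x| < `|x - y|.
  rewrite -ltr_pdivlMr// (@le_lt_trans _ _ (`|x - y| / `|x| / 2))//; last lra.
  by rewrite ge_min lexx orbT.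
have yle : `|y| <= `|x| by rewrite yx.
have /(le_trans mid) := Ed _ _ _ _ e2 (lexx _) yle ed.
by rewrite leNgt gtr_pMl//; lra.
Qed.

Lemma ball_modulus_uniformly_convex (E : completeNormedModType R) :
  ball_modulus delta E -> uniformly_convex E.
Proof.
have half (eps : R) : 0 < eps <= 2 -> 0 < eps / 2 <= 2 by lra.
move=> Ed.
(* Halving turns the weak inequality into the strict one of the ball modulus. *)
exists (fun eps => delta (eps / 2)); split=> [eps /half/delta_bound//|].
move=> eps e2 x y x1 y1 exy; rewrite -[leRHS]mulr1.
by apply: Ed (half _ e2) _ _ _; rewrite ?x1 ?y1// mulr1; lra.
Qed.

(** Coordinates of a point of the ball of radius [r] need not lie in that ball;
    they do so along [U] for any larger radius [r']. *)
Lemma ball_modulus_ultraproducts (U : nonprincipal_ultrafilter) :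
  closed_under_ultraproducts U (ball_modulus delta).
Proof.
move=> E Ed eps r p q e2 pr qr epq.
have [x xp] := ultraclass_surj p; have [y yq] := ultraclass_surj q.
move: pr qr epq; rewrite -{}xp -{}yq => xr yr exy.
have mE : 2^-1 *: (ultraclass U x + ultraclass U y) =
    ultraclass U (2^-1 *: (x + y)) by rewrite ultraclassZ ultraclassD.
have dE : ultraclass U x - ultraclass U y = ultraclass U (x - y).
  by rewrite ultraclassD ultraclassN.
rewrite mE norm_ultraclass; move: xr yr exy; rewrite dE !norm_ultraclass => xr yr exy.
have [de0 de1] := andP (delta_bound e2); have [e0 _] := andP e2.
pose eta0 := (ultralimit_norm U (x - y) - eps * r) / eps / 2.
have eta00 : 0 < eta0 by rewrite !divr_gt0// subr_gt0.
apply/ler_addgt0Pr => eta etapos.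
pose r' := r + Num.min eta eta0.
have m0 : 0 < Num.min eta eta0 by rewrite lt_min etapos.
have rr' : r < r' by rewrite /r' ltrDl.
have er' : eps * r' < ultralimit_norm U (x - y).
  have : eps * Num.min eta eta0 <= eps * eta0.
    by rewrite ler_wpM2l ?(ltW e0)// ge_min lexx orbT.
  have -> : eps * eta0 = (ultralimit_norm U (x - y) - eps * r) / 2.
    by rewrite /eta0 mulrC mulrAC divfK// gt_eqF.
  by rewrite /r' mulrDr; lra.
apply: (@le_trans _ _ ((1 - delta eps) * r')).
  apply: (cvgr_to_le (@ultralimit_norm_cvg _ U _ (2^-1 *: (x + y)))).
  have nx : \forall n \near ultrafilter_sets U, `|x n| <= r'.
    exact: cvgr_le (@ultralimit_norm_cvg _ U _ x) _ (le_lt_trans xr rr').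
  have ny : \forall n \near ultrafilter_sets U, `|y n| <= r'.
    exact: cvgr_le (@ultralimit_norm_cvg _ U _ y) _ (le_lt_trans yr rr').
  have nd : \forall n \near ultrafilter_sets U, eps * r' < `|(x - y) n|.
    exact: cvgr_gt (@ultralimit_norm_cvg _ U _ (x - y)) _ er'.
  apply: filterS3 nd nx ny => n dn xn yn.
  exact: Ed e2 xn yn dn.
rewrite /r' mulrDr lerD2l (@le_trans _ _ (Num.min eta eta0))//.
  by rewrite ler_piMl ?(ltW m0)//; lra.
by rewrite ge_min lexx.
Qed.

End BallModulus.

(** Passage from unit vectors to the unit ball: a vector of norm well below 1
    makes the midpoint short by the triangle inequality, and two vectors of norm
    almost 1 are close to their normalizations. *)
Lemma uniformly_convex_unit_ball (E : completeNormedModType R) :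
  uniformly_convex E -> exists delta : R -> R,
    (forall eps, 0 < eps <= 2 -> 0 < delta eps <= 1) /\
    forall eps (x y : E), 0 < eps <= 2 -> `|x| <= 1 -> `|y| <= 1 ->
      eps < `|x - y| -> `|2^-1 *: (x + y)| <= 1 - delta eps.
Proof.
move=> [delta [delta01 deltaE]].
(* The second bound leaves half of the gain after normalizing both vectors. *)
pose t eps := Num.min (eps / 4) (delta (eps / 2) / 2).
have half (eps : R) : 0 < eps <= 2 -> 0 < eps / 2 <= 2 by lra.
have t0 eps : 0 < eps <= 2 -> 0 < t eps.
  by move=> e2; rewrite lt_min; have := delta01 _ (half _ e2); lra.
have te eps : t eps <= eps / 4 by rewrite ge_min lexx.
have td eps : t eps <= delta (eps / 2) / 2 by rewrite ge_min lexx orbT.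
exists (fun eps => t eps / 2); split=> [eps e2|eps x y e2 x1 y1 exy].
  by have := t0 _ e2; have := te eps; lra.
have midE (u v : E) : `|2^-1 *: (u + v)| = `|u + v| / 2.
  by rewrite normrZ gtr0_norm ?invr_gt0// mulrC.
have := t0 _ e2; have := te eps; have := td eps; rewrite midE => te_ td_ t0_.
have := ler_normD x y.
have [xs|xs] := leP `|x| (1 - t eps); first lra.
have [ys|ys] := leP `|y| (1 - t eps); first lra.
move=> _.
have unit_dist (z : E) : z != 0 -> `|z| <= 1 ->
    `|(`|z|^-1 *: z)| = 1 /\ `|z - `|z|^-1 *: z| = 1 - `|z|.
  move=> z0 z1; have nz : `|z| != 0 by rewrite normr_eq0.
  split; first by rewrite normrZ normfV normr_id mulVf.
  rewrite -{1}(scale1r z) -scalerBl normrZ distrC ger0_norm.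
    by rewrite mulrBl mulVf// mul1r.
  by rewrite subr_ge0 invf_ge1// normr_gt0.
have [x0 y0] : x != 0 /\ y != 0.
  by rewrite -!normr_gt0; split; lra.
have [x'1 xx'] := unit_dist _ x0 x1; have [y'1 yy'] := unit_dist _ y0 y1.
set x' := _ *: x in x'1 xx'; set y' := _ *: y in y'1 yy'.
have split_ (u v u' v' : E) : u + v = (u - u') + (v - v') + (u' + v').
  by rewrite addrACA !subrK.
have far : eps / 2 <= `|x' - y'|.
  have := ler_normD ((x - x') + (- y - - y')) (x' - y').
  have := ler_normD (x - x') (- y - - y').
  by rewrite -split_ -opprD normrN xx' yy'; lra.
have := deltaE _ (half _ e2) _ _ x'1 y'1 far; rewrite midE.
have := ler_normD ((x - x') + (y - y')) (x' + y').
have := ler_normD (x - x') (y - y').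
by rewrite -split_ xx' yy'; lra.
Qed.

Lemma uniformly_convex_ball_modulus (E : completeNormedModType R) :
  uniformly_convex E -> exists delta : R -> R,
    (forall eps, 0 < eps <= 2 -> 0 < delta eps <= 1) /\ ball_modulus delta E.
Proof.
move=> /uniformly_convex_unit_ball[delta [delta01 deltaE]].
exists delta; split=> // eps r x y e2 xr yr exy.
have r0 : 0 < r.
  rewrite lt_neqAle (le_trans (normr_ge0 x) xr) andbT; apply/eqP => r0.
  move: exy xr yr; rewrite -r0 mulr0; have := ler_normB x y; lra.
have sc (z : E) : `|r^-1 *: z| = `|z| / r.
  by rewrite normrZ gtr0_norm ?invr_gt0// mulrC.
have := deltaE eps (r^-1 *: x) (r^-1 *: y) e2.
rewrite -scalerBr -scalerDr scalerA mulrC -scalerA !sc.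
rewrite !ler_pdivrMr// ltr_pdivlMr// !mul1r; exact.
Qed.

End FixedPointSynthesis.

Theorem theorem1p4 (R : realType) (U : nonprincipal_ultrafilter)
    (G : groupType) (EE : completeNormedModType R -> Prop)
    (V : Type) (adj : V -> V -> Prop) (N Hp Hm : V -> set G)
    (G_fg : finitely_generated G)
    (G_ab : finite_abelianization G)
    (EE_uc : forall E, EE E -> uniformly_convex E)
    (EE_class : closed_under_ultraproducts U EE \/
                (forall E, EE E <-> uniformly_convex E))
    (adj_undirected : undirected adj)
    (adj_connected : connected_graph adj)
    (N_subgroup : forall v, subgroup (N v))
    (Hp_subgroup : forall v, subgroup (Hp v))
    (Hm_subgroup : forall v, subgroup (Hm v))
    (cond1 : forall v, normalizes (N v) (Hp v) /\ normalizes (N v) (Hm v))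
    (cond2 : forall v, generated (Hp v `|` Hm v) = [set: G])
    (cond3 : forall u v, adj u v ->
       [/\ Hp u `<=` generated (Hp v `|` N v),
           Hp v `<=` generated (Hp u `|` N u),
           Hm u `<=` generated (Hm v `|` N v) &
           Hm v `<=` generated (Hm u `|` N u)])
    (cond4 : generated (\bigcup_v (Hp v `|` N v)) = [set: G])
    (cond5 : forall v, rel_property_F_class G (Hp v) EE /\
                       rel_property_F_class G (Hm v) EE) :
  property_F_class G EE.
Proof.
have adj_half u v : adj u v -> Hp u `<=` generated (Hp v `|` N v) /\
    Hm u `<=` generated (Hm v `|` N v) by move=> /cond3[].
move=> E EE_E; have [delta [delta01 Edelta]] := uniformly_convex_ball_modulus (EE_uc E EE_E).
case: EE_class => [EE_ultra|EE_all].
  apply: (fixed_point_synthesis G_fg G_ab EE_ultra _ adj_undirected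
    adj_connected cond1 cond2 adj_half cond4 cond5) => // F /EE_uc.
  move=> /uniformly_convex_ball_modulus[d [d01]].
  exact: ball_modulus_strictly_convex.
have sub F : ball_modulus delta F -> EE F.
  move=> Fd; apply: (EE_all F).2.
  exact: (ball_modulus_uniformly_convex delta01 Fd).
have relF v : rel_property_F_class G (Hp v) (ball_modulus delta) /\
    rel_property_F_class G (Hm v) (ball_modulus delta).
  by split=> F /sub; [exact: (cond5 v).1|exact: (cond5 v).2].
apply: (fixed_point_synthesis G_fg G_ab
  (ball_modulus_ultraproducts delta01 (U := U)) _ adj_undirected
  adj_connected cond1 cond2 adj_half cond4 relF) => // F.
exact: ball_modulus_strictly_convex.
Qed.
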